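(* Let $n,a,t,k$ be positive integers with $a\ge 2$, $1\le t\le n-1$, and suppose that one of the following holds: (a) $k\ge at$ and $(a-1)t>a(an-k)+(a-2)n$; (b) $k\le at$ and $t>(a+1)k-n$. Then $G(\alpha;n,an-t,k)=\emptyset$ for all $\alpha>0$.
   Context: We work over $\mathbb{C}$ on the projective line $\mathbb{P}^1$. A coherent system of type $(n,d,k)$ is a pair $(E,V)$ where $E$ is a vector bundle on $\mathbb{P}^1$ of rank $n$ and degree $d$ and $V\subset H^0(E)$ is a linear subspace of dimension $k$. A subsystem of $(E,V)$ is a coherent system $(E',V')$ with $E'\subset E$ a nonzero subbundle and $V'\subset V\cap H^0(E')$; it is proper if $(E',V')\ne(E,V)$. For $\alpha\in\mathbb{R}$ the $\alpha$-slope is $\mu_\alpha(E,V)=\frac{d+\alpha k}{n}$, and $(E,V)$ is $\alpha$-stable if $\mu_\alpha(E',V')<\mu_\alpha(E,V)$ for every proper subsystem $(E',V')$. $G(\alpha;n,d,k)$ denotes the moduli space of $\alpha$-stable coherent systems of type $(n,d,k)$ on $\mathbb{P}^1$; its points are the isomorphism classes of such systems. *)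

(* Defs.v *)
From HB Require Import structures.
From mathcomp Require Import all_boot all_order all_algebra.
From mathcomp Require Import classical_sets reals.
From mathcomp Require Import complex.

Set Implicit Arguments.
Unset Strict Implicit.
Unset Printing Implicit Defensive.

Import GRing.Theory.
Local Open Scope classical_set_scope.
Local Open Scope ring_scope.

(* The complex numbers are R[i], where R : realType. The projective line is   *)
(* covered by two affine charts, with coordinate rings C[z] and C[w], glued   *)
(* along w = z^-1. Both rings are represented by {poly R[i]} and embedded in  *)
(* the function field C(z), the second one by p |-> p(z^-1).                  *)

Definition funfield (R : realType) := {fraction {poly R[i]}}.

Definition zvar (R : realType) : funfield R := tofrac 'X.

Definition chart0 (R : realType) (p : {poly R[i]}) : funfield R := tofrac p.

Definition chart1 (R : realType) (p : {poly R[i]}) : funfield R :=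
  (map_poly (fun c : R[i] => tofrac c%:P : funfield R) p).[(zvar R)^-1].

Definition laurent (R : realType) (f : funfield R) : Prop :=
  exists (m : nat) (p : {poly R[i]}), f = tofrac p / zvar R ^+ m.

(* A vector bundle of rank n, given by its transition matrix in               *)
(* GL_n(C[z, z^-1]): every vector bundle on an affine line is trivial, so     *)
(* every vector bundle on P^1 arises in this way. The units of C[z, z^-1] are *)
(* the c z^d with c <> 0, so det_glue says both that the matrix is invertible *)
(* over that ring and that the determinant line bundle is O(d). A section is  *)
(* a pair (s0, s1) with s0(z) = glue(z) s1(z^-1); thus glue = z^d in rank 1   *)
(* gives O(d), whose sections are the s0 of degree at most d.                 *)
Record vbundle (R : realType) (n : nat) := VBundle {
  glue : 'M[funfield R]_n;
  degree : int;
  glue_laurent : forall i j, laurent (glue i j);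
  det_glue : exists2 c : R[i], c != 0 &
    \det glue = tofrac c%:P * zvar R ^ degree
}.

Definition is_section (R : realType) (n : nat) (E : vbundle R n)
    (s : 'cV[{poly R[i]}]_n * 'cV[{poly R[i]}]_n) : Prop :=
  map_mx (@chart0 R) s.1 = glue E *m map_mx (@chart1 R) s.2.

Definition H0 (R : realType) (n : nat) (E : vbundle R n) :
    set ('cV[{poly R[i]}]_n * 'cV[{poly R[i]}]_n) :=
  [set s | is_section E s].

(* V is a complex linear subspace of dimension k. The scalars are complex     *)
(* numbers, seen as constant polynomials; V is not a module over polynomials. *)
Definition is_subspace_of_dim (R : realType) (n k : nat)
    (V : set ('cV[{poly R[i]}]_n * 'cV[{poly R[i]}]_n)) : Prop :=
  exists b : 'I_k -> 'cV[{poly R[i]}]_n * 'cV[{poly R[i]}]_n,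
    (forall c : 'I_k -> R[i],
       \sum_(i < k) (c i)%:P *: b i = 0 -> forall i, c i = 0) /\
    V = [set s | exists c : 'I_k -> R[i], s = \sum_(i < k) (c i)%:P *: b i].

Record coherent_system (R : realType) (n k : nat) := CoherentSystem {
  bundle : vbundle R n;
  sections : set ('cV[{poly R[i]}]_n * 'cV[{poly R[i]}]_n);
  sections_H0 : sections `<=` H0 bundle;
  sections_dim : is_subspace_of_dim k sections
}.

(* A morphism of bundles F -> E is a pair of matrices, one over each chart,   *)
(* which agree on the overlap.                                                *)
Definition is_hom (R : realType) (m n : nat) (F : vbundle R m)
    (E : vbundle R n) (f : 'M[{poly R[i]}]_(n, m) * 'M[{poly R[i]}]_(n, m)) :
    Prop :=
  map_mx (@chart0 R) f.1 *m glue F = glue E *m map_mx (@chart1 R) f.2.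

Definition push (R : realType) (m n : nat)
    (f : 'M[{poly R[i]}]_(n, m) * 'M[{poly R[i]}]_(n, m))
    (s : 'cV[{poly R[i]}]_m * 'cV[{poly R[i]}]_m) :
    'cV[{poly R[i]}]_n * 'cV[{poly R[i]}]_n :=
  (f.1 *m s.1, f.2 *m s.2).

Definition fibre (R : realType) (m n : nat) (A : 'M[{poly R[i]}]_(n, m))
    (x : R[i]) : 'M[R[i]]_(n, m) :=
  map_mx (horner_eval x) A.

(* The inclusion of a subbundle is a morphism that is injective on every      *)
(* fibre (as opposed to a mere inclusion of sheaves). The matrices act on     *)
(* columns.                                                                   *)
Definition is_subbundle (R : realType) (m n : nat) (F : vbundle R m)
    (E : vbundle R n) (f : 'M[{poly R[i]}]_(n, m) * 'M[{poly R[i]}]_(n, m)) :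
    Prop :=
  is_hom F E f /\
  forall x : R[i], \rank (fibre f.1 x) = m /\ \rank (fibre f.2 x) = m.

Definition is_subsystem (R : realType) (n' k' n k : nat)
    (S' : coherent_system R n' k') (S : coherent_system R n k)
    (f : 'M[{poly R[i]}]_(n, n') * 'M[{poly R[i]}]_(n, n')) : Prop :=
  [/\ (0 < n')%N,
      is_subbundle (bundle S') (bundle S) f &
      push f @` sections S' `<=` sections S].

(* The subsheaf which is the image of f is all of the target.                 *)
Definition is_onto (R : realType) (m n : nat)
    (f : 'M[{poly R[i]}]_(n, m) * 'M[{poly R[i]}]_(n, m)) : Prop :=
  (exists B : 'M[{poly R[i]}]_(m, n), f.1 *m B = 1%:M) /\
  (exists B : 'M[{poly R[i]}]_(m, n), f.2 *m B = 1%:M).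

Definition is_proper_subsystem (R : realType) (n' k' n k : nat)
    (S' : coherent_system R n' k') (S : coherent_system R n k)
    (f : 'M[{poly R[i]}]_(n, n') * 'M[{poly R[i]}]_(n, n')) : Prop :=
  is_subsystem S' S f /\
  ~ (is_onto f /\ push f @` sections S' = sections S).

Definition slope (R : realType) (alpha : R) (n k : nat)
    (S : coherent_system R n k) : R :=
  ((degree (bundle S))%:~R + alpha * k%:R) / n%:R.

Definition stable (R : realType) (alpha : R) (n k : nat)
    (S : coherent_system R n k) : Prop :=
  forall (n' k' : nat) (S' : coherent_system R n' k')
      (f : 'M[{poly R[i]}]_(n, n') * 'M[{poly R[i]}]_(n, n')),
    is_proper_subsystem S' S f -> slope alpha S' < slope alpha S.

Definition isomorphic (R : realType) (n k : nat)
    (S T : coherent_system R n k) : Prop :=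
  exists f : 'M[{poly R[i]}]_n * 'M[{poly R[i]}]_n,
    [/\ f.1 \in unitmx, f.2 \in unitmx,
        is_hom (bundle S) (bundle T) f &
        push f @` sections S = sections T].

Definition iso_class (R : realType) (n k : nat) (S : coherent_system R n k) :
    set (coherent_system R n k) :=
  [set T | isomorphic S T].

(* The set of points of the moduli space G(alpha; n, d, k). *)
Definition moduli (R : realType) (alpha : R) (n : nat) (d : int) (k : nat) :
    set (set (coherent_system R n k)) :=
  [set iso_class S | S in
     [set S : coherent_system R n k |
        degree (bundle S) = d /\ stable alpha S]].

Arguments moduli {R} alpha n d k.

(* Main.v *)
Require Import Defs.
From HB Require Import structures.
From mathcomp Require Import all_boot all_order all_algebra perm.
From mathcomp Require Import boolp classical_sets reals.
From mathcomp Require Import complex.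
From mathcomp Require Import zify ring lra.

Set Implicit Arguments.
Unset Strict Implicit.
Unset Printing Implicit Defensive.

Import Order.TTheory GRing.Theory Num.Theory.
Local Open Scope classical_set_scope.
Local Open Scope ring_scope.

(** Every bundle E on P^1 splits: E = O(d_1) + ... + O(d_n). In these
    coordinates a section is a vector of polynomials x with deg x_i <= d_i, a
    homomorphism O(b) -> E is a column p with deg p_i <= d_i - b, and a
    homomorphism E -> O(b) is a row p with deg p_i <= b - d_i. Let D = an - t be
    the degree and suppose that (E,V) is alpha-stable for some alpha > 0. Each
    case produces two contradictory bounds on alpha, one from a map out of a
    line bundle, and one from a map onto a line bundle.

    A nonzero homomorphism O(b) -> E factors through a line subbundle of degree
    at least b; if m independent sections of O(b) land in V, stability gives
    n (b + alpha m) < D + alpha k. A nonzero homomorphism E -> O(b) has as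
    kernel a subbundle of rank n - 1 and degree at least D - b; if m independent
    elements of V lie in that kernel, stability gives
    n (D - b + alpha m) < (n - 1) (D + alpha k). These two inequalities are the
    last two clauses of [stable_splitting].

    Case (b). As D > (a-1) n, some d_i is at least a, and O(d_i) in E gives
    t < alpha k. On the other hand dim Hom(E, O(a)) >= n (a+1) - D = n + t
    exceeds k (a+1), the number of linear conditions for a homomorphism to O(a)
    to kill k sections, so some nonzero E -> O(a) kills V
    ([exists_hom_killing]); its kernel gives alpha k < t.

    Case (a). The projection of E onto a summand O(d_i) kills a subspace of V of
    dimension at least k - h^0(O(d_i)). Stability then excludes d_i < 0, and for
    a summand with d_i <= a - 1, which exists as D < a n, it gives
    D + alpha k < n (a - 1 + alpha a). Since no d_i is negative,
    h^0(E) = D + n, and the inequality of (a) says that Hom(O(a-1), E), of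
    dimension at least D - (a-1) n + n, is larger than a (h^0(E) - k), the
    number of linear conditions for all a basis sections of O(a-1) to land in
    V. So some nonzero O(a-1) -> E maps H^0(O(a-1)) into V
    ([exists_line_with_sections]), which gives the opposite inequality.

    Two facts about bundles carry this. The splitting ([birkhoff]) and the
    factorization through a subbundle or a quotient bundle ([saturation]) both
    come from column reduction of polynomial matrices ([column_reduction]). *)

(** * Column reduction of polynomial matrices *)

Definition col_size (F : fieldType) m n (P : 'M[{poly F}]_(m, n)) (j : 'I_n) :=
  \max_i size (P i j).

(** Here [col_size P j] is the degree of column [j] plus one. A zero column has
    size 0, and the predecessor below is then harmless: the coefficients are
    all 0. *)
Definition lead_mx (F : fieldType) m n (P : 'M[{poly F}]_(m, n)) : 'M[F]_(m, n) :=
  \matrix_(i, j) (P i j)`_(col_size P j).-1.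

(** Predictable degrees: the leading vectors of the nonzero columns are linearly
    independent. Zero columns are allowed, so that the notion makes sense for
    singular and for non-square matrices. *)
Definition column_reduced (F : fieldType) m n (P : 'M[{poly F}]_(m, n)) :=
  forall c : 'cV[F]_n, lead_mx P *m c = 0 ->
    forall j, c j 0 = 0 \/ col_size P j = 0%N.

(** The matrix is the identity with column [j] replaced by [v]. It is a rank one
    perturbation [1 + M] of the identity with [M ^ 2 = (v_j - 1) M], and so its
    inverse is [1 - v_j^-1 M]. *)
Lemma set_col_unit (A : comUnitRingType) n (j : 'I_n) (v : 'cV[A]_n) :
  v j 0 \is a GRing.unit ->
  1%:M + (v - delta_mx j 0) *m delta_mx 0 j \in unitmx.
Proof.
move=> Uv; set M := _ *m _.
have MM : M *m M = (v j 0 - 1) *: M.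
  rewrite /M -mulmxA (mulmxA (delta_mx 0 j)) -rowE.
  rewrite [row _ _]mx11_scalar !mxE !eqxx /= mul_scalar_mx.
  by rewrite -scalemxAr.
have : (1%:M + M) *m (1%:M - (v j 0)^-1 *: M) = 1%:M.
  rewrite mulmxDl mul1mx mulmxBr mulmx1 -scalemxAr MM scalerA -addrA.
  rewrite mulrBr mulVr // mulr1 scalerBl scale1r opprB.
  by rewrite [M + _]addrC subrK addNr addr0.
by case/mulmx1_unit.
Qed.

Lemma set_col_mul (A : comUnitRingType) m n (P : 'M[A]_(m, n)) (j : 'I_n)
    (v : 'cV[A]_n) i l :
  (P *m (1%:M + (v - delta_mx j 0) *m delta_mx 0 j)) i l =
  if l == j then (P *m v) i 0 else P i l.
Proof.
rewrite mulmxDr mulmx1 mulmxA mulmxBr mxE.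
rewrite -colE [X in _ + X]mxE big_ord1 !mxE eqxx /=.
by case: eqVneq => [->|_]; rewrite ?mulr1 ?mulr0 ?addr0 // addrC subrK.
Qed.

(** Induction on the sum of the column sizes. A linear relation between the
    leading vectors of nonzero columns, multiplied by suitable powers of ['X],
    is a combination of columns in which the top coefficient of the longest
    column involved cancels; replacing that column by the combination is
    invertible and shortens it. *)
Lemma column_reduction (F : fieldType) m n (P : 'M[{poly F}]_(m, n)) :
  exists2 A : 'M[{poly F}]_n, A \in unitmx & column_reduced (P *m A).
Proof.
have [N] := ubnP (\sum_j col_size P j)%N.
elim: N => // N IH in P *; rewrite ltnS => leN.
have [|nred] := pselect (column_reduced P).
  by exists 1%:M; rewrite ?unitmx1 ?mulmx1.
have [c [cK [j0 [cj0 sj0]]]] : exists c : 'cV[F]_n, lead_mx P *m c = 0 /\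
    exists j, c j 0 != 0 /\ (0 < col_size P j)%N.
  apply: contrapT => H; apply: nred => c cK j.
  apply: contrapT => /not_orP[c0 s0]; apply: H; exists c; split=> //.
  by exists j; split; [apply/eqP | rewrite lt0n; apply/eqP].
pose good j := (c j 0 != 0) && (0 < col_size P j)%N.
(* [j] is the longest column that takes part in the relation [c]. *)
have gj0 : good j0 by rewrite /good cj0.
case: (arg_maxnP (fun j => col_size P j) gj0) => j /andP[cj sj] jmax.
pose e := col_size P.
pose v : 'cV[{poly F}]_n :=
  \col_l (if good l then (c l 0)%:P * 'X^(e j - e l) else 0).
have vj : v j 0 = (c j 0)%:P.
  by rewrite mxE /good cj sj /= subnn expr0 mulr1.
have sz i l : (size (P i l) <= e l)%N by apply: (leq_bigmax i).
have Uv : v j 0 \is a GRing.unit.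
  by rewrite vj rmorph_unit // unitfE.
set T := 1%:M + (v - delta_mx j 0) *m delta_mx 0 j.
have UT : T \in unitmx by apply: set_col_unit.
have PT := @set_col_mul _ _ _ P j v; rewrite -/T in PT.
have smaller : (col_size (P *m T) j < e j)%N.
  rewrite -[e j]prednK // ltnS; apply/bigmax_leqP => i _.
  rewrite PT eqxx; apply/leq_sizeP => q; rewrite leq_eqVlt => /orP[/eqP <-|ltq].
    have /matrixP/(_ i 0) := cK; rewrite !mxE => cKi.
    rewrite coef_sum -[RHS]cKi; apply: eq_bigr => l _.
    rewrite !mxE /good; case: (eqVneq (c l 0) 0) => [->|cl]; first by rewrite !mulr0 coef0.
    case: posnP => [l0|lpos] /=.
      have -> : P i l = 0.
        by apply/eqP; rewrite -size_poly_leq0 -l0.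
      by rewrite mul0r !coef0 mul0r.
    have lej : (e l <= e j)%N by apply: jmax; rewrite /good cl.
    rewrite mulrCA coefCM coefMXn.
    have lpos' : (0 < e l)%N by [].
    rewrite -/(e j) -/(e l) ifF; last by lia.
    have -> : ((e j).-1 - (e j - e l) = (e l).-1)%N by lia.
    by rewrite mulrC.
  rewrite mxE coef_sum big1 // => l _; rewrite !mxE.
  case: ifP => [/andP[cl lpos]|_]; last by rewrite mulr0 coef0.
  have lej : (e l <= e j)%N by apply: jmax; rewrite /good cl.
  rewrite mulrCA coefCM coefMXn; case: ifP => [_|/negbT]; first by rewrite mulr0.
  rewrite -leqNgt => H.
  rewrite nth_default ?mulr0 //; apply: leq_trans (sz i l) _.
  have : (e j <= q)%N by case: (e j) sj ltq.
  by move=> jq; rewrite leq_subRL // subnK.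
have same l : l != j -> col_size (P *m T) l = e l.
  by move=> lj; apply: eq_bigr => i _; rewrite PT (negbTE lj).
have [|A UA redA] := IH (P *m T).
  apply: leq_trans leN; rewrite (bigD1 j) //= [ltnRHS](bigD1 j) //= -addSn leq_add //.
  by rewrite leq_eqVlt; apply/orP; left; apply/eqP; apply: eq_bigr => l /same.
by exists (T *m A); rewrite ?unitmx_mul ?UT // mulmxA.
Qed.

(** In a column reduced matrix with a single row, the leading vectors are
    scalars, so that at most one entry is nonzero: column reduction is then
    the Euclidean algorithm. *)
Lemma row_gcd (F : fieldType) n (p : 'rV[{poly F}]_n.+1) :
  exists2 A : 'M[{poly F}]_n.+1, A \in unitmx &
    exists g, p *m A = g *: delta_mx 0 0.
Proof.
have [A UA] := column_reduction p; move defQ: (p *m A) => Q red.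
have cs j : col_size Q j = size (Q 0 j) by rewrite /col_size big_ord1.
have uniq_nz j l : Q 0 j != 0 -> Q 0 l != 0 -> j = l.
  move=> Qj Ql; apply/eqP/negPn/negP => jl.
  pose c : 'cV[F]_n.+1 := lead_coef (Q 0 l) *: delta_mx j 0
    - lead_coef (Q 0 j) *: delta_mx l 0.
  have /red/(_ j)[] : lead_mx Q *m c = 0.
  - apply/matrixP => i i'; rewrite !ord1 mulmxBr -!scalemxAr -!colE !mxE !cs.
    by rewrite /lead_coef mulrC subrr.
  - move/eqP; rewrite !mxE !eqxx (negbTE jl) /= mulr0 subr0 mulr1.
    by rewrite lead_coef_eq0 (negbTE Ql).
  - by move/eqP; rewrite cs size_poly_eq0 (negbTE Qj).
have [j Qj] : exists j, forall l, l != j -> Q 0 l = 0.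
  have [[j Qj]|no] := pselect (exists j, Q 0 j != 0).
    exists j => l lj; apply/eqP/negPn/negP => Ql.
    by move/eqP: lj; apply; apply: uniq_nz.
  exists 0 => l _; apply/eqP/negPn/negP => Ql; apply: no; by exists l.
exists (A *m tperm_mx 0 j); first by rewrite unitmx_mul UA unitmx_perm.
exists (Q 0 j); rewrite mulmxA defQ -xcolE.
apply/rowP => l; rewrite !mxE eqxx /=.
case: (eqVneq l 0) => [->|l0] /=; first by rewrite tpermL mulr1.
rewrite mulr0; apply: Qj; rewrite -[X in _ == X](tpermL 0 j).
by rewrite (inj_eq perm_inj).
Qed.

(** * The two charts and Laurent polynomials *)

Section Charts.
Variable R : realType.
Local Notation P := {poly R[i]}.
Local Notation K := (funfield R).
Local Notation z := (zvar R).
Local Notation chart0 := (@chart0 R).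
Local Notation chart1 := (@chart1 R).
Implicit Types (p q : P) (b : int) (f : K).

Fact chart0_is_zmod_morphism : zmod_morphism chart0.
Proof. exact: rmorphB. Qed.
Fact chart0_is_monoid_morphism : monoid_morphism chart0.
Proof. by split; [exact: rmorph1 | exact: rmorphM]. Qed.
HB.instance Definition _ :=
  GRing.isZmodMorphism.Build P K chart0 chart0_is_zmod_morphism.
HB.instance Definition _ :=
  GRing.isMonoidMorphism.Build P K chart0 chart0_is_monoid_morphism.

Lemma chart1_horner_morph p :
  chart1 p = (map_poly (chart0 \o polyC) p).[z^-1].
Proof. by []. Qed.

Fact chart1_is_zmod_morphism : zmod_morphism chart1.
Proof. by move=> p q; rewrite !chart1_horner_morph rmorphB hornerD hornerN. Qed.
Fact chart1_is_monoid_morphism : monoid_morphism chart1.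
Proof.
by split=> [|p q]; rewrite !chart1_horner_morph ?rmorph1 ?hornerC // rmorphM hornerM.
Qed.
HB.instance Definition _ :=
  GRing.isZmodMorphism.Build P K chart1 chart1_is_zmod_morphism.
HB.instance Definition _ :=
  GRing.isMonoidMorphism.Build P K chart1 chart1_is_monoid_morphism.

Lemma zvar_neq0 : z != 0.
Proof. by rewrite tofrac_eq0 polyX_eq0. Qed.

Lemma chart0_eq0 p : (chart0 p == 0) = (p == 0).
Proof. exact: tofrac_eq0. Qed.

Lemma chart0_inj : injective chart0.
Proof. by move=> p q /eqP; rewrite tofrac_eq => /eqP. Qed.

Lemma chart0X n : chart0 'X^n = z ^+ n.
Proof. exact: rmorphXn. Qed.

Lemma chart1C c : chart1 c%:P = chart0 c%:P.
Proof. by rewrite chart1_horner_morph map_polyC hornerC. Qed.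

Lemma chart1E m p : (size p <= m)%N ->
  chart1 p = \sum_(i < m) chart0 (p`_i)%:P * z ^- i.
Proof.
move=> le_pm; rewrite chart1_horner_morph (@horner_coef_wide _ m).
  by apply: eq_bigr => i _; rewrite coef_map exprVn.
exact: leq_trans (size_poly _ _) le_pm.
Qed.

(** The polynomial [z^m p(1/z)], when [p] has degree at most [m]. *)
Definition reverse m p : P := \poly_(i < m.+1) p`_(m - i).

Lemma size_reverse m p : (size (reverse m p) <= m.+1)%N.
Proof. exact: size_poly. Qed.

Lemma chart1_reverse m p : (size p <= m.+1)%N ->
  chart1 p = z ^- m * chart0 (reverse m p).
Proof.
move=> le_pm; rewrite (chart1E le_pm) /reverse poly_def rmorph_sum mulr_sumr.
rewrite (reindex_inj rev_ord_inj) /=; apply: eq_bigr => i _; rewrite subSS.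
have lim : (i <= m)%N by rewrite -ltnS.
rewrite -mul_polyC [chart0 (_ * _)]rmorphM /= chart0X mulrCA; congr (_ * _).
move: (nat_of_ord i) lim => j lim.
by rewrite -[in RHS](subnK lim) exprD invfM mulfVK // expf_neq0 ?zvar_neq0.
Qed.

Lemma reverseK m p : (size p <= m.+1)%N -> reverse m (reverse m p) = p.
Proof.
move=> le_pm; apply/polyP => i; rewrite !coef_poly !ltnS.
case: leqP => [lim|lt_mi]; first by rewrite leq_subr subKn.
by rewrite nth_default // (leq_trans le_pm).
Qed.

Lemma chart0_reverse m p : (size p <= m.+1)%N ->
  chart0 p = z ^+ m * chart1 (reverse m p).
Proof.
move=> le_pm; rewrite (chart1_reverse (size_reverse m p)) reverseK // mulrA.
by rewrite divff ?mul1r // expf_neq0 ?zvar_neq0.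
Qed.

Lemma chart1_inj : injective chart1.
Proof.
move=> p q /eqP; rewrite -subr_eq0 -rmorphB /=; set r := p - q.
have le_r : (size r <= (size r).+1)%N by [].
rewrite (chart1_reverse le_r) mulf_eq0 invr_eq0 expf_eq0 (negbTE zvar_neq0) andbF /=.
rewrite chart0_eq0 => /eqP r0; apply/eqP; rewrite -subr_eq0 -/r.
by rewrite -(reverseK le_r) r0 /reverse poly_def big1 // => i _; rewrite coef0 scale0r.
Qed.

(** The dimension of H^0(O(b)): the number of powers [z ^ i] with
    [0 <= i <= b]. *)
Definition h0 b : nat := if b is Posz m then m.+1 else 0%N.

(** On the overlap [p] is a combination of the [z ^ (b - i)], [0 <= i], and as a
    polynomial it has no negative powers. *)
Lemma chart_size p q b : chart0 p = z ^ b * chart1 q -> (size p <= h0 b)%N.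
Proof.
have le_q : (size q <= (size q).+1)%N by [].
have := size_reverse (size q) q; rewrite (chart1_reverse le_q).
move: (size q) (reverse _ _) => m r szr.
have zm0 : z ^+ m != 0 by rewrite expf_neq0 ?zvar_neq0.
have [->|p0] := eqVneq p 0; first by rewrite size_poly0.
case: b => [b|b] /=.
  move=> E.
  have /chart0_inj/(congr1 (fun p : P => size p)) : chart0 (p * 'X^m) = chart0 ('X^b * r).
    by rewrite !rmorphM /= !chart0X E -exprnP -mulrA (mulrAC _ _ (z ^+ m)) mulVf // mul1r.
  rewrite size_mulXn // [_ * r]mulrC.
  have [->|r0] := eqVneq r 0.
    by rewrite mul0r size_poly0 => /eqP; rewrite addn_eq0 => /andP[_ /eqP->].
  rewrite size_mulXn // => H.
  by rewrite -(leq_add2l m) H addnS -addSn addnC leq_add2r.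
move=> E.
have /chart0_inj/(congr1 (fun p : P => size p)) : chart0 (p * 'X^(m + b.+1)) = chart0 r.
  have cancel (F : fieldType) (x y u : F) : x != 0 -> y != 0 ->
    y^-1 * (x^-1 * u) * (x * y) = u by move=> *; field; apply/andP.
  rewrite rmorphM /= chart0X E exprD NegzE -exprnN cancel //.
  by rewrite expf_neq0 ?zvar_neq0.
rewrite size_mulXn // => H; move: szr p0; rewrite -H -size_poly_eq0.
by rewrite addnS addSn ltnS -[leqRHS]addn0 -addnA leq_add2l leqn0 addn_eq0 => /andP[_ ->].
Qed.

Lemma chart_lift p b : (size p <= h0 b)%N ->
  exists q, chart0 p = z ^ b * chart1 q.
Proof.
case: b => [m|m] /= le_p; first by exists (reverse m p); apply: chart0_reverse.
exists 0; have -> : p = 0 by apply/eqP; rewrite -size_poly_leq0.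
by rewrite !rmorph0 mulr0.
Qed.

Lemma laurent_chart0 p : laurent (chart0 p).
Proof. by exists 0%N, p; rewrite expr0 divr1. Qed.

Lemma laurent0 : laurent (0 : K).
Proof. by rewrite -[0](rmorph0 chart0); apply: laurent_chart0. Qed.

Lemma laurent_chart1 p : laurent (chart1 p).
Proof.
exists (size p), (reverse (size p) p).
by rewrite (@chart1_reverse (size p)) // mulrC.
Qed.

Lemma laurentM f g : laurent f -> laurent g -> laurent (f * g).
Proof.
move=> [m [p ->]] [k [q ->]]; exists (m + k)%N, (p * q).
by rewrite rmorphM exprD invfM mulrACA.
Qed.

Lemma laurentD f g : laurent f -> laurent g -> laurent (f + g).
Proof.
move=> [m [p ->]] [k [q ->]]; exists (m + k)%N, (p * 'X^k + q * 'X^m).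
have zn j : z ^+ j != 0 by rewrite expf_neq0 ?zvar_neq0.
by rewrite addf_div // -exprD rmorphD !rmorphM !rmorphXn.
Qed.

Lemma laurent_expz b : laurent (z ^ b).
Proof.
case: b => b; first by rewrite -exprnP -chart0X; apply: laurent_chart0.
by exists b.+1, 1; rewrite NegzE -exprnN rmorph1 mul1r.
Qed.

Lemma laurent_sum (I : Type) (r : seq I) (f : I -> K) :
  (forall i, laurent (f i)) -> laurent (\sum_(i <- r) f i).
Proof.
move=> Lf; apply: big_ind => [|x y|i _]; [exact: laurent0| exact: laurentD|exact: Lf].
Qed.

Lemma laurent_mulmx m n k (A : 'M[K]_(m, n)) (B : 'M[K]_(n, k)) :
  (forall i j, laurent (A i j)) -> (forall i j, laurent (B i j)) ->
  forall i j, laurent ((A *m B) i j).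
Proof.
by move=> LA LB i j; rewrite mxE; apply: laurent_sum => l; apply: laurentM.
Qed.

(** If [f = p / z^m] and [g = q / z^k] then [p q] is a power of the variable, and
    so is [p] up to a constant. *)
Lemma laurent_unit f g : laurent f -> laurent g -> f * g = 1 ->
  exists2 c : R[i], c != 0 & exists b, f = chart0 c%:P * z ^ b.
Proof.
move=> [m [p ->]] [k [q ->]] E.
have zn j : z ^+ j != 0 by rewrite expf_neq0 ?zvar_neq0.
have /chart0_inj pq : chart0 (p * q) = chart0 ('X^(m + k)).
  rewrite chart0X rmorphM exprD -[RHS]mul1r -E.
  by rewrite mulf_div -/(chart0 p) -/(chart0 q) mulfVK // mulf_neq0.
have : p %| ('X - 0%:P) ^+ (m + k) by rewrite subr0 -pq dvdp_mulr.
case/dvdp_exp_XsubCP => j _; rewrite subr0 => /eqp_eq E2.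
have p0 : p != 0.
  by apply: contra_eq_neq pq => ->; rewrite mul0r eq_sym expf_neq0 // polyX_eq0.
have H : lead_coef p *: 'X^j = p by rewrite -E2 lead_coefXn scale1r.
exists (lead_coef p); first by rewrite lead_coef_eq0.
exists (j%:Z - m%:Z); have -> : tofrac p = chart0 (lead_coef p)%:P * z ^+ j.
  by rewrite -chart0X -rmorphM mul_polyC H.
by rewrite expfzDr ?zvar_neq0 // -exprnN -exprnP mulrA.
Qed.

End Charts.

(** * Splitting of bundles and saturation of line subsheaves *)

Lemma poly_unit_const (F : fieldType) (p : {poly F}) :
  p \is a GRing.unit -> exists2 c : F, c != 0 & p = c%:P.
Proof.
rewrite poly_unitE => /andP[/eqP s1 u]; exists p`_0; first by rewrite -unitfE.
by apply: size1_polyC; rewrite s1.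
Qed.

(** A row of a unimodular matrix vanishes at no point, so [g] collects all the
    zeros of [p] in the chart. *)
Lemma row_primitive (F : fieldType) n (p : 'rV[{poly F}]_n.+1) :
  exists2 U : 'M[{poly F}]_n.+1, U \in unitmx & exists g, p = g *: row 0 U.
Proof.
have [A UA [g pA]] := row_gcd p; exists (invmx A); first by rewrite unitmx_inv.
by exists g; rewrite rowE scalemxAl -pA mulmxK.
Qed.

Section Bundles.
Variable R : realType.
Local Notation P := {poly R[i]}.
Local Notation K := (funfield R).
Local Notation z := (zvar R).
Local Notation chart0 := (@chart0 R).
Local Notation chart1 := (@chart1 R).

(** Large powers of [z] absorb the positive powers that occur in [f]. *)
Lemma laurent_large f : laurent f ->
  exists N, forall M, (N <= M)%N -> exists q, f = z ^+ M * chart1 q.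
Proof.
move=> [m [p ->]]; exists (size p) => M le_pM.
exists ('X^(M + m - size p) * reverse (size p) p).
rewrite -/(chart0 p) (@chart0_reverse _ (size p)) // rmorphM rmorphXn /=.
have -> : chart1 'X = z^-1.
  rewrite (@chart1_reverse _ 1) ?size_polyX // expr1 /reverse poly_def.
  rewrite !big_ord_recl big_ord0 !coefX /=.
  by rewrite scale1r scale0r !addr0 rmorph1 mulr1.
have z0 := zvar_neq0 R.
have zn j : z ^+ j != 0 by rewrite expf_neq0.
rewrite exprVn.
have cancel (F : fieldType) (s x y w c : F) : x != 0 -> y != 0 -> w != 0 ->
  x * y = w * s -> s * c / y = x * (w^-1 * c).
  move=> x0 y0 w0 xy; apply: (mulIf (mulf_neq0 w0 y0)).
  have -> : s * c / y * (w * y) = (w * s) * c by field.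
  by rewrite -xy; field.
set w := z ^+ (M + m - size p); set s := z ^+ size p.
set x := z ^+ M; set y := z ^+ m.
move: (chart1 _) => c0.
have E : x * y = w * s by rewrite -!exprD subnK //; lia.
exact: (cancel K s x y w c0 (zn _) (zn _) (zn _) E).
Qed.

Lemma expfz_sum (I : finType) (d : I -> int) :
  \prod_i z ^ d i = z ^ (\sum_i d i).
Proof.
by apply/esym/(big_morph (fun b : int => z ^ b)) => // x y; rewrite expfzDr ?zvar_neq0.
Qed.

Lemma reverse_horner0 m (p : P) : (reverse m p).[0] = p`_m.
Proof. by rewrite horner_coef0 coef_poly subn0. Qed.

(** A bundle on P^1 is a sum of line bundles. Column reduction over the ring of
    the chart at infinity turns the gluing matrix into [Q], whose columns of
    degree [e j] have independent leading vectors. Dividing the columns by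
    their top powers of [1/z] leaves a matrix [A] which is polynomial in [z],
    and [\det A] does not vanish at 0, where [A] is the matrix of leading
    vectors. As [\det A] is also a constant times a power of [z], it is
    constant, and [A] is invertible over the chart at 0. *)
Lemma birkhoff n (E : vbundle R n) :
  exists (d : 'I_n -> int) (A B : 'M[P]_n),
  [/\ A \in unitmx, B \in unitmx, \sum_i d i = degree E &
   glue E *m map_mx chart1 B =
   map_mx chart0 A *m diag_mx (\row_i z ^ d i)].
Proof.
have z0 := zvar_neq0 R.
have zn j : z ^+ j != 0 by rewrite expf_neq0.
(* After division by a common power of [z], all entries are polynomials in
   [1/z], so that column reduction applies. *)
have [N NP] : exists N, forall M, (N <= M)%N ->
    forall ij : 'I_n * 'I_n, exists q, glue E ij.1 ij.2 = z ^+ M * chart1 q.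
  have [f fP] := choice (fun ij : 'I_n * 'I_n =>
    laurent_large (glue_laurent E ij.1 ij.2)).
  exists (\max_ij f ij) => M leM ij; apply: fP; apply: leq_trans leM.
  exact: leq_bigmax.
have [f fP] := choice (NP N (leqnn N)).
pose P0 : 'M[P]_n := \matrix_(i, j) f (i, j).
have gP : glue E = z ^+ N *: map_mx chart1 P0.
  by apply/matrixP => i j; rewrite !mxE (fP (i, j)).
have [B UB] := column_reduction P0; move defQ: (P0 *m B) => Q red.
have [c c0 dE] := det_glue E.
have [b b0 dB] := poly_unit_const UB.
have dQ0 : \det Q != 0.
  apply/eqP => dQ; move/eqP: dE; apply/negP.
  have : \det P0 * \det B = 0 by rewrite -det_mulmx defQ.
  move/eqP; rewrite mulf_eq0 dB polyC_eq0 (negbTE b0) orbF => /eqP dP.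
  rewrite gP detZ det_map_mx dP rmorph0 mulr0 eq_sym.
  apply: mulf_neq0; last exact: expfz_neq0.
  by rewrite tofrac_eq0 polyC_eq0.
pose e j := (col_size Q j).-1.
have szQ i j : (size (Q i j) <= (e j).+1)%N.
  rewrite /e; have := @leq_bigmax _ (fun i => size (Q i j)) i; rewrite -/(col_size Q j).
  by case: (col_size Q j) => [|s] //; lia.
(* No column of [Q] is zero, so the degree [e j] is not a truncated value. *)
have epos j : col_size Q j != 0%N.
  apply: contra_neq dQ0 => s0; rewrite (expand_det_col _ j) big1 // => i _.
  suff -> : Q i j = 0 by rewrite mul0r.
  apply/eqP; rewrite -size_poly_leq0 -s0; exact: (leq_bigmax i).
pose A : 'M[P]_n := \matrix_(i, j) reverse (e j) (Q i j).
pose d j : int := N%:Z - (e j)%:Z.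
have gA : glue E *m map_mx chart1 B = map_mx chart0 A *m diag_mx (\row_i z ^ d i).
  rewrite gP -scalemxAl -map_mxM defQ; apply/matrixP => i j.
  rewrite mul_mx_diag !mxE /= (@chart1_reverse _ (e j)) // /d expfzDr // -exprnN -exprnP.
  by rewrite mulrA mulrC.
have dA0 : (\det A).[0] != 0.
  have -> : (\det A).[0] = \det (lead_mx Q).
    rewrite -[LHS]/(horner_eval 0 (\det A)) -det_map_mx; congr (\det _).
    by apply/matrixP => i j; rewrite !mxE /= /horner_eval reverse_horner0.
  rewrite -unitfE -[_ \is a _]/(lead_mx Q \in unitmx) -unitmx_tr -row_free_unit.
  apply: inj_row_free => v vL; apply/rowP => j.
  have /red/(_ j)[] : lead_mx Q *m v^T = 0.
  - by rewrite -[lead_mx Q]trmxK -trmx_mul vL trmx0.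
  - by rewrite !mxE.
  - by move/eqP; rewrite (negbTE (epos j)).
have dAE : chart0 (\det A) = z ^ (degree E - \sum_i d i) * chart1 (c * b)%:P.
  have := congr1 determinant gA; rewrite !det_mulmx !det_map_mx det_diag dE dB.
  under eq_bigr do rewrite mxE.
  rewrite expfz_sum polyCM /= !chart1C -/(chart0 c%:P) => H.
  have cancel (F : fieldType) (u v w x y : F) : y != 0 ->
    w * x * v = u * y -> u = x / y * (w * v).
    by move=> y0 wxv; apply: (mulIf y0); rewrite -wxv; field.
  rewrite expfzDr // -invr_expz rmorphM /= !chart1C.
  by apply: cancel H; rewrite expfz_neq0.
have dA1 : \det A != 0 by apply: contraNneq dA0 => ->; rewrite horner0.
have := chart_size dAE.
move: dAE; case Db: (degree E - \sum_i d i) => [s|s] /= dAE; last first.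
  by rewrite size_poly_leq0 (negbTE dA1).
move=> _.
have dA : \det A = 'X^s * (c * b)%:P.
  by apply: (@chart0_inj R); rewrite rmorphM /= chart0X dAE chart1C.
have s0 : s = 0%N.
  case: (s) dA dA0 => // s' ->; rewrite hornerM hornerXn expr0n /=.
  by rewrite mul0r eqxx.
exists d, A, B; split => //; last by apply/esym/eqP; rewrite -subr_eq0 Db s0.
rewrite unitmxE dA s0 expr0 mul1r rmorph_unit // unitfE mulf_neq0 //.
Qed.

(** A homomorphism from a split bundle to O(b), given by [p] and [q] in the two
    charts, factors through a quotient line bundle O(b') with [b' <= b].
    Removing the zeros of [p] and of [q] leaves rows of unimodular matrices
    that are still proportional on the overlap. The factor of proportionality
    is Laurent, and so is its inverse, because a row of a unimodular matrix has
    a right inverse; hence it is [c z^b']. For negated [d] and [b] the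
    statement is the dual one, on homomorphisms O(b) -> E. *)
Lemma saturation n (d : 'I_n.+1 -> int) b (p q : 'rV[P]_n.+1) :
  p != 0 -> (forall i, chart0 (p 0 i) * z ^ d i = z ^ b * chart1 (q 0 i)) ->
  exists (U V : 'M[P]_n.+1) g (c : R[i]) b',
  [/\ U \in unitmx, V \in unitmx, c != 0, (b' <= b)%R & g != 0 /\ p = g *: row 0 U] /\
  forall i, chart0 (U 0 i) * z ^ d i = chart0 c%:P * z ^ b' * chart1 (V 0 i).
Proof.
move=> p0 pq; have z0 := zvar_neq0 R.
have [U UU [g pU]] := row_primitive p; have [V UV [h qV]] := row_primitive q.
have g0 : g != 0 by apply: contra_neq p0 => g0; rewrite pU g0 scale0r.
have pq' i : chart0 g * chart0 (U 0 i) * z ^ d i = z ^ b * (chart1 h * chart1 (V 0 i)).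
  by have := pq i; rewrite pU qV !mxE !rmorphM.
have zd i : z ^ d i != 0 by rewrite expfz_neq0.
have U1 : \sum_i U 0 i * invmx U i 0 = 1.
  by have := congr1 (fun M : 'M_n.+1 => M 0 0) (mulmxV UU); rewrite !mxE.
have V1 : \sum_i V 0 i * invmx V i 0 = 1.
  by have := congr1 (fun M : 'M_n.+1 => M 0 0) (mulmxV UV); rewrite !mxE.
(* [x] is the factor of proportionality of the two unimodular rows, and [y] is
   its inverse. *)
pose x := \sum_i chart0 (U 0 i) * z ^ d i * chart1 (invmx V i 0).
pose y := \sum_i (z ^ - d i) * chart1 (V 0 i) * chart0 (invmx U i 0).
have gx : chart0 g * x = z ^ b * chart1 h.
  transitivity (z ^ b * chart1 h * chart1 (\sum_i V 0 i * invmx V i 0)); last first.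
    by rewrite V1 rmorph1 mulr1.
  rewrite rmorph_sum !mulr_sumr; apply: eq_bigr => i _.
  by rewrite rmorphM /= !mulrA pq' !mulrA.
have hy : z ^ b * chart1 h * y = chart0 g.
  transitivity (chart0 g * chart0 (\sum_i U 0 i * invmx U i 0)); last first.
    by rewrite U1 rmorph1 mulr1.
  rewrite rmorph_sum !mulr_sumr; apply: eq_bigr => i _.
  rewrite rmorphM /= !mulrA; congr (_ * _).
  rewrite mulrAC -(mulrA (z ^ b)) -pq' -invr_expz.
  exact: mulfK (zd i) _.
have g0' : chart0 g != 0 by rewrite chart0_eq0.
have xy : x * y = 1 by apply: (mulfI g0'); rewrite mulrA gx hy mulr1.
have [c c0 [b' xE]] : exists2 c : R[i], c != 0 & exists b, x = chart0 c%:P * z ^ b.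
  apply: laurent_unit xy; apply: laurent_sum => i.
    by apply: laurentM; [apply: laurentM|];
      [apply: laurent_chart0|apply: laurent_expz|apply: laurent_chart1].
  by apply: laurentM; [apply: laurentM|];
    [apply: laurent_expz|apply: laurent_chart1|apply: laurent_chart0].
exists U, V, g, c, b'; split; first split=> //.
  have E : chart0 (g * c%:P) = z ^ (b - b') * chart1 h.
    apply: (mulIf (expfz_neq0 b' z0)); rewrite rmorphM /= -mulrA -xE gx.
    by rewrite [RHS]mulrAC -(expfzDr _ _ z0) subrK.
  have := chart_size E; case Db: (b - b') => [s|s] /=.
    by move=> _; rewrite -subr_ge0 Db.
  by rewrite size_poly_leq0 mulf_eq0 polyC_eq0 (negbTE g0) (negbTE c0).
move=> i; apply: (mulfI g0'); rewrite mulrA pq' mulrA -gx xE.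
by rewrite !mulrA.
Qed.

End Bundles.

(** * Slopes of subsystems *)

Section Sub.
Variable R : realType.
Local Notation P := {poly R[i]}.
Local Notation chart0 := (@chart0 R).
Local Notation chart1 := (@chart1 R).
Local Notation sec n := ('cV[P]_n * 'cV[P]_n)%type.

Lemma glue_unit n (E : vbundle R n) : glue E \in unitmx.
Proof.
have [c c0 dE] := det_glue E; rewrite unitmxE dE unitfE.
apply: mulf_neq0; first by rewrite tofrac_eq0 polyC_eq0.
exact: expfz_neq0 (zvar_neq0 R).
Qed.

Lemma map_chart1_inj m n : injective (@map_mx _ _ chart1 m n).
Proof.
move=> A B /matrixP E; apply/matrixP => i j; apply: (@chart1_inj R).
by have := E i j; rewrite !mxE.
Qed.

Lemma section_eq n (E : vbundle R n) (s t : sec n) :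
  is_section E s -> is_section E t -> s.1 = t.1 -> s = t.
Proof.
case: s t => [s1 s2] [t1 t2]; rewrite /is_section /= => Es Et st; rewrite -st in Et *.
congr pair; apply: map_chart1_inj.
by rewrite -(mulKmx (glue_unit E) (map_mx _ s2)) -Es Et mulKmx ?glue_unit.
Qed.

Definition lincomb n k (b : 'I_k -> sec n) (c : 'I_k -> R[i]) : sec n :=
  \sum_(i < k) (c i)%:P *: b i.

Definition independent n k (b : 'I_k -> sec n) :=
  forall c : 'I_k -> R[i], lincomb b c = 0 -> forall i, c i = 0.

Lemma lincomb1 n k (b : 'I_k -> sec n) c :
  (lincomb b c).1 = \sum_(i < k) (c i)%:P *: (b i).1.
Proof. by rewrite /lincomb raddf_sum. Qed.

Lemma lincomb2 n k (b : 'I_k -> sec n) c :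
  (lincomb b c).2 = \sum_(i < k) (c i)%:P *: (b i).2.
Proof. by rewrite /lincomb raddf_sum. Qed.

Lemma lincomb_lincomb n k k' (b : 'I_k -> sec n) (C : 'M[R[i]]_(k', k)) c :
  lincomb (fun r => lincomb b (C r)) c =
  lincomb b (fun j => \sum_r c r * C r j).
Proof.
rewrite /lincomb; under eq_bigr do rewrite scaler_sumr.
rewrite exchange_big; apply: eq_bigr => j _ /=.
by rewrite rmorph_sum scaler_suml; apply: eq_bigr => r _; rewrite scalerA rmorphM.
Qed.

Lemma push_lincomb m n k (f : 'M[P]_(n, m) * 'M[P]_(n, m)) (b : 'I_k -> sec m) c :
  push f (lincomb b c) = lincomb (fun i => push f (b i)) c.
Proof.
apply: injective_projections => /=; [rewrite !lincomb1 | rewrite !lincomb2].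
  by rewrite mulmx_sumr; apply: eq_bigr => i _; rewrite -scalemxAr.
by rewrite mulmx_sumr; apply: eq_bigr => i _; rewrite -scalemxAr.
Qed.

Lemma section_lincomb n (E : vbundle R n) k (b : 'I_k -> sec n) c :
  (forall i, is_section E (b i)) -> is_section E (lincomb b c).
Proof.
move=> Eb; rewrite /is_section lincomb1 lincomb2 !raddf_sum /=.
apply: eq_bigr => i _; rewrite !map_mxZ /= chart1C Eb.
exact: scalemxAr.
Qed.

(** A left inverse over the chart specializes to a left inverse on each fibre. *)
Lemma rank_left_inv m n (A : 'M[P]_(n, m)) L x :
  L *m A = 1%:M -> \rank (fibre A x) = m.
Proof.
move=> LA; apply/eqP; rewrite eqn_leq rank_leq_col /=.
have := mxrankM_maxr (fibre L x) (fibre A x).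
by rewrite /fibre -map_mxM LA map_mx1 mxrank1.
Qed.

Lemma not_onto m n (f : 'M[P]_(n, m) * 'M[P]_(n, m)) : (m < n)%N -> ~ is_onto f.
Proof.
move=> mn [[B fB] _]; have := mxrankM_maxl (fibre f.1 0) (fibre B 0).
rewrite /fibre -map_mxM fB map_mx1 mxrank1 => H.
by have := leq_trans H (rank_leq_col _); rewrite leqNgt mn.
Qed.

(** A family of independent sections of [S] that factor through [f] in the first
    chart factors through [f] as sections of [F]: the left inverse [L2]
    determines the components in the second chart. With these sections [F]
    is a proper subsystem, since its rank is too small for [f] to be onto. *)
Lemma subsystem_slope (alpha : R) n k (S : coherent_system R n k) m
    (F : vbundle R m) (f : 'M[P]_(n, m) * 'M[P]_(n, m)) (L1 L2 : 'M[P]_(m, n))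
    k' (s : 'I_k' -> sec n) :
  stable alpha S -> (0 < m < n)%N -> is_hom F (bundle S) f ->
  L1 *m f.1 = 1%:M -> L2 *m f.2 = 1%:M ->
  (forall r, sections S (s r)) -> independent s ->
  (forall r, exists t, (s r).1 = f.1 *m t) ->
  ((degree F)%:~R + alpha * k'%:R) / m%:R < slope alpha S.
Proof.
move=> stS /andP[m0 mn] hom L1f L2f Ss ind fs.
pose t r : sec m := (L1 *m (s r).1, L2 *m (s r).2).
have ft1 r : f.1 *m (t r).1 = (s r).1.
  by have [u su] := fs r; rewrite /= su (mulmxA L1) L1f mul1mx.
have Es r : is_section (bundle S) (s r) by apply: (sections_H0 (Ss r)).
have Ft r : is_section F (t r).
  have E : glue (bundle S) *m map_mx chart1 (s r).2 =
    glue (bundle S) *m map_mx chart1 f.2 *m invmx (glue F) *m map_mx chart0 (t r).1.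
    by rewrite -hom mulmxK ?glue_unit // -map_mxM ft1 -Es.
  rewrite /is_section.
  have -> : map_mx chart1 (t r).2 = map_mx chart1 L2 *m map_mx chart1 (s r).2.
    by rewrite -map_mxM.
  have /(congr1 (mulmx (invmx (glue (bundle S))))) := E.
  rewrite -!mulmxA !mulKmx ?glue_unit // => ->.
  by rewrite (mulmxA (map_mx _ L2)) -map_mxM L2f map_mx1 mul1mx mulKVmx ?glue_unit.
have pt r : push f (t r) = s r.
  apply: (@section_eq _ (bundle S)) => //; last exact: ft1.
  move: (t r) (Ft r) => u Fu.
  by rewrite /is_section /push !map_mxM Fu !mulmxA hom.
pose V := [set x | exists c, x = lincomb t c].
have VH : V `<=` H0 F by move=> _ [c ->]; apply: section_lincomb.
have Vdim : is_subspace_of_dim k' V.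
  exists t; split => // c tc; apply: ind.
  have := congr1 (push f) tc; rewrite -/(lincomb t c) push_lincomb.
  have -> : push f 0 = 0 by rewrite /push !mulmx0.
  by rewrite /lincomb; under eq_bigr do rewrite pt.
pose S' := CoherentSystem VH Vdim.
apply: (stS _ _ S' f); split; last by case=> /(not_onto mn).
split=> //.
  by split=> // x; rewrite (rank_left_inv _ L1f) (rank_left_inv _ L2f).
move=> _ [_ [c ->] <-]; rewrite push_lincomb.
have [b [_ Vb]] := sections_dim S; rewrite Vb in Ss *.
have [C CP] := choice Ss.
exists (fun j => \sum_r c r * (\matrix_(i, j) C i j : 'M[R[i]]_(k', k)) r j).
rewrite -/(lincomb b _) -lincomb_lincomb; apply: eq_bigr => r _.
rewrite pt CP; congr (_ *: _); apply: eq_bigr => j _; by rewrite mxE.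
Qed.

End Sub.

(** * Line subbundles and kernels of maps to line bundles *)

Section Tests.
Variable R : realType.
Local Notation P := {poly R[i]}.
Local Notation K := (funfield R).
Local Notation z := (zvar R).
Local Notation chart0 := (@chart0 R).
Local Notation chart1 := (@chart1 R).
Local Notation sec n := ('cV[P]_n * 'cV[P]_n)%type.

Lemma line_bundle (c : R[i]) b : c != 0 ->
  exists2 F : vbundle R 1, degree F = b & glue F = (chart0 c%:P * z ^ b)%:M.
Proof.
move=> c0.
have Lg i j : laurent (((chart0 c%:P * z ^ b)%:M : 'M[K]_1) i j).
  rewrite !ord1 mxE eqxx mulr1n.
  by apply: laurentM; [apply: laurent_chart0 | apply: laurent_expz].
have dg : exists2 c' : R[i], c' != 0 &
    \det ((chart0 c%:P * z ^ b)%:M : 'M[K]_1) = tofrac c'%:P * z ^ b.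
  by exists c => //; rewrite det_scalar1.
by exists (VBundle Lg dg).
Qed.

Lemma row_mul_inv n (U : 'M[P]_n.+1) : U \in unitmx ->
  row 0 U *m col 0 (invmx U) = 1%:M.
Proof.
move=> UU; rewrite colE mulmxA -row_mul mulmxV // row1 mul_delta_mx.
by apply/matrixP => i j; rewrite !ord1 !mxE.
Qed.

(** The column [p] is a homomorphism O(b) -> E, and its saturation is a line
    subbundle of degree at least [b], by [saturation] for the dual bundles. The
    sections [N r] of O(b) become sections of it. *)
Lemma line_subbundle_slope (alpha : R) n k (S : coherent_system R n.+1 k)
    (d : 'I_n.+1 -> int) (A B : 'M[P]_n.+1) (p : 'cV[P]_n.+1) b
    m (N : 'I_m -> P) (s : 'I_m -> sec n.+1) :
  stable alpha S -> (0 < n)%N -> A \in unitmx -> B \in unitmx ->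
  glue (bundle S) *m map_mx chart1 B = map_mx chart0 A *m diag_mx (\row_i z ^ d i) ->
  p != 0 -> (forall i, (size (p i 0%R) <= h0 (d i - b)%R)%N) ->
  (forall c : 'I_m -> R[i], \sum_r (c r)%:P * N r = 0 -> forall r, c r = 0) ->
  (forall r, sections S (s r)) -> (forall r, (s r).1 = A *m (N r *: p)) ->
  b%:~R + alpha * m%:R < slope alpha S.
Proof.
move=> stS n0 UA UB gAB p0 psz Nind Ss sN.
have z0 := zvar_neq0 R.
have [q qP] := choice (fun i => chart_lift (psz i)).
have [||U [V [g [c [b' [[UU UV c0 bb' [g0 pU]] UVE]]]]]] :=
  @saturation R n (fun i => - d i) (- b) p^T (\row_i q i).
- by apply: contra_neq p0 => /(congr1 trmx); rewrite trmxK trmx0.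
- move=> i; rewrite !mxE qP mulrAC -(expfzDr _ _ z0); congr (z ^ _ * _).
  by rewrite addrAC subrr add0r.
have ci0 : c^-1 != 0 by rewrite invr_eq0.
have [F dF gF] := line_bundle (- b') ci0.
have -> : b%:~R + alpha * m%:R = (b%:~R + alpha * m%:R) / 1%:R by rewrite divr1.
apply: (@le_lt_trans _ _ (((degree F)%:~R + alpha * m%:R) / 1%:R)).
  by rewrite !divr1 lerD2r ler_int dF lerNr.
pose f : 'M[P]_(n.+1, 1) * 'M[P]_(n.+1, 1) := (A *m (row 0 U)^T, B *m (row 0 V)^T).
have left_inv (X W : 'M[P]_n.+1) : X \in unitmx -> W \in unitmx ->
    ((col 0 (invmx W))^T *m invmx X) *m (X *m (row 0 W)^T) = 1%:M.
  move=> UX UW; rewrite mulmxA mulmxKV // -trmx_mul row_mul_inv //.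
  exact: trmx1.
have pE : p = g *: (row 0 U)^T by rewrite -[p]trmxK pU linearZ.
apply: (@subsystem_slope R alpha _ _ S _ F f _ _ _ s stS _ _
  (left_inv A U UA UU) (left_inv B V UB UV) Ss).
- by rewrite /= ltnS.
- rewrite /is_hom gF !map_mxM mulmxA gAB -!mulmxA; congr (_ *m _).
  rewrite mul_mx_scalar mul_diag_mx; apply/matrixP => i j; rewrite !mxE /=.
  have := UVE i; rewrite -invr_expz => E.
  have cancel (M : fieldType) (x y w u v : M) : y != 0 -> w != 0 -> u != 0 ->
    x / y = u * w * v -> (u^-1 * w^-1) * x = y * v.
    move=> y0 w0 u0 e; have -> : x = x / y * y by field.
    by rewrite e; field; apply/andP.
  rewrite -(invr_expz z b').
  have -> : chart0 (c^-1)%:P = (chart0 c%:P)^-1.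
    exact: (fmorphV (chart0 \o polyC)).
  apply: (cancel K) E; try exact: expfz_neq0 z0.
  by rewrite tofrac_eq0 polyC_eq0.
- move=> e se; apply: Nind; have := congr1 (fun x => x.1) se.
  rewrite lincomb1 /=; under eq_bigr do rewrite sN scalemxAr scalerA.
  rewrite -mulmx_sumr -scaler_suml => /(congr1 (mulmx (invmx A))).
  rewrite mulKmx // mulmx0 => /eqP; rewrite scalemx_eq0 (negbTE p0) orbF => /eqP.
  by [].
- by move=> r; exists ((g * N r)%:M); rewrite sN pE scalerA mul_mx_scalar -scalemxAr mulrC.
Qed.

(** The row [p] is a homomorphism E -> O(b), and by [saturation] its kernel is
    that of a surjection onto some O(b') with [b' <= b], given in each chart by
    the first row of a unimodular matrix. In the bases defined by these two
    matrices the gluing matrix is block triangular, [c z^b'] being its upper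
    left entry; the complementary block glues the kernel, whose degree is
    thus [degree (bundle S) - b']. *)
Lemma kernel_subbundle_slope (alpha : R) n k (S : coherent_system R n.+1 k)
    (d : 'I_n.+1 -> int) (A B : 'M[P]_n.+1) (p : 'rV[P]_n.+1) b
    m (s : 'I_m -> sec n.+1) :
  stable alpha S -> (0 < n)%N -> A \in unitmx -> B \in unitmx ->
  glue (bundle S) *m map_mx chart1 B = map_mx chart0 A *m diag_mx (\row_i z ^ d i) ->
  \sum_i d i = degree (bundle S) ->
  p != 0 -> (forall i, (size (p 0%R i) <= h0 (b - d i)%R)%N) ->
  independent s ->
  (forall r, sections S (s r)) -> (forall r, p *m (invmx A *m (s r).1) = 0) ->
  ((degree (bundle S) - b)%:~R + alpha * m%:R) / n%:R < slope alpha S.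
Proof.
move=> stS n0 UA UB gAB sumd p0 psz ind Ss ps.
have z0 := zvar_neq0 R.
have [q qP] := choice (fun i => chart_lift (psz i)).
have [|U [V [g [c [b' [[UU UV c0 bb' [g0 pU]] UVE]]]]]] :=
  @saturation R n d b p (\row_i q i) p0.
- move=> i; rewrite !mxE qP mulrAC -(expfzDr _ _ z0); congr (z ^ _ * _).
  by rewrite subrK.
pose D : 'M[K]_n.+1 := diag_mx (\row_i z ^ d i).
have [G defG] : exists G : 'M[K]_(1 + n),
    G = map_mx chart0 U *m D *m map_mx chart1 (invmx V) by eexists.
have rowG : row 0 G = (chart0 c%:P * z ^ b') *: delta_mx 0 0.
  have -> : row 0 G = (chart0 c%:P * z ^ b') *:
      (row 0 (map_mx chart1 V) *m map_mx chart1 (invmx V)).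
    rewrite defG row_mul scalemxAl; congr (_ *m _).
    by apply/rowP => i; rewrite /D mul_mx_diag !mxE UVE.
  by rewrite -row_mul -map_mxM mulmxV // map_mx1 row1.
(* In the new bases the homomorphism to O(b') is the first coordinate. *)
have ulG : ulsubmx G = (chart0 c%:P * z ^ b')%:M.
  apply/matrixP => i j; rewrite !ord1; have /rowP/(_ 0) := rowG.
  rewrite !mxE !eqxx mulr1 mulr1n => <-; congr (G _ _); exact: val_inj.
have urG : ursubmx G = 0.
  apply/matrixP => i j; rewrite !ord1; have /rowP/(_ (rshift 1 j)) := rowG.
  rewrite !mxE eqxx /= mulr0 => <-; congr (G _ _); exact: val_inj.
pose H := drsubmx G.
have GE : G = block_mx (chart0 c%:P * z ^ b')%:M 0 (dlsubmx G) H.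
  by rewrite -ulG -urG submxK.
have [uu uu0 dU] := poly_unit_const UU.
have UVi : invmx V \in unitmx by rewrite unitmx_inv.
have [vv vv0 dV] := poly_unit_const UVi.
have detD : \det D = z ^ degree (bundle S).
  by rewrite det_diag -sumd -expfz_sum; apply: eq_bigr => i _; rewrite mxE.
have detH : \det H = tofrac (uu * vv / c)%:P * z ^ (degree (bundle S) - b').
  have : \det G = chart0 uu%:P * z ^ degree (bundle S) * chart0 vv%:P.
    by rewrite defG !det_mulmx detD !det_map_mx dU dV /= chart1C.
  rewrite GE det_lblock det_scalar1 expfzDr // -invr_expz -/(chart0 _).
  have -> : chart0 (uu * vv / c)%:P = chart0 uu%:P * chart0 vv%:P / chart0 c%:P.
    rewrite -[(chart0 c%:P)^-1](fmorphV (chart0 \o polyC)) /=.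
    by rewrite !polyCM !rmorphM.
  have cancel (M : fieldType) (x y u v w h : M) : x != 0 -> w != 0 ->
    x * w * h = u * y * v -> h = u * v / x * (y / w).
    move=> x0 w0 e; have -> : h = x * w * h / (x * w) by field; apply/andP.
    by rewrite e; field; apply/andP.
  apply: cancel; last exact: expfz_neq0 z0.
  by rewrite tofrac_eq0 polyC_eq0.
have LG : forall i j, laurent (G i j).
  rewrite defG; apply: laurent_mulmx => [|i j]; last by rewrite mxE; apply: laurent_chart1.
  apply: laurent_mulmx => i j; first by rewrite mxE; apply: laurent_chart0.
  rewrite !mxE; case: eqP => _; first exact: laurent_expz.
  exact: laurent0.
have LH : forall i j, laurent (H i j) by move=> i j; rewrite !mxE.
have uvc0 : uu * vv / c != 0 by rewrite !mulf_neq0 ?invr_eq0.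
pose F := VBundle LH (ex_intro2 _ _ (uu * vv / c) uvc0 detH).
pose Ui : 'M[P]_(1 + n) := invmx U; pose Vi : 'M[P]_(1 + n) := invmx V.
have left_inv (X W : 'M[P]_n.+1) : X \in unitmx -> W \in unitmx ->
    (@dsubmx _ 1 n _ W *m invmx X) *m (X *m @rsubmx _ _ 1 n (invmx W)) = 1%:M.
  move=> UX UW; rewrite mulmxA mulmxKV // mul_dsub_mx mulmx_rsub mulmxV //.
  by rewrite (@scalar_mx_block _ 1 n) block_mxEh row_mxKr col_mxKd.
pose f : 'M[P]_(n.+1, n) * 'M[P]_(n.+1, n) := (A *m rsubmx Ui, B *m rsubmx Vi).
apply: (@le_lt_trans _ _ (((degree F)%:~R + alpha * m%:R) / n%:R)).
  by rewrite ler_pM2r ?invr_gt0 ?ltr0n // lerD2r ler_int /= lerB.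
apply: (@subsystem_slope R alpha _ _ S _ F f _ _ _ s stS _ _
  (left_inv A U UA UU) (left_inv B V UB UV) Ss ind).
- by rewrite n0 ltnSn.
- have UG : map_mx chart0 Ui *m G = D *m map_mx chart1 Vi.
    by rewrite defG !mulmxA -map_mxM mulVmx // map_mx1 mul1mx.
  rewrite /is_hom !map_mxM mulmxA gAB -!mulmxA; congr (_ *m _).
  rewrite !map_rsubmx -/D [RHS]mulmx_rsub -UG GE -[map_mx chart0 Ui in RHS]hsubmxK.
  by rewrite mul_row_block row_mxKr mulmx0 add0r.
- move=> r; have := ps r; rewrite pU -scalemxAl => /eqP.
  rewrite scalemx_eq0 (negbTE g0) /= => /eqP.
  move: (s r).1 => x; rewrite -row_mul => ux.
  move defy: (U *m (invmx A *m x)) ux => y uy.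
  have y0 : @usubmx _ 1 n _ y = 0.
    apply/matrixP => i j; rewrite !ord1; have /matrixP/(_ 0 0) := uy.
    by rewrite !mxE => <-; congr (y _ _); apply: val_inj.
  exists (@dsubmx _ 1 n _ y).
  have -> : x = A *m (Ui *m y) by rewrite -defy mulKmx // mulKVmx.
  rewrite -[y in LHS](@vsubmxK _ 1 n) y0 -[Ui in LHS]hsubmxK mul_row_col mulmx0 add0r.
  by rewrite /f /= !mulmxA.
Qed.

End Tests.

(** * Stability in split coordinates *)

Lemma nontrivial_solution (F : fieldType) (I J : finType) (M : I -> J -> F) :
  (#|J| < #|I|)%N ->
  exists c : I -> F, (exists i, c i != 0) /\ forall j, \sum_i c i * M i j = 0.
Proof.
move=> ltJI; pose A : 'M[F]_(#|I|, #|J|) := \matrix_(u, v) M (enum_val u) (enum_val v).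
have : kermx A != 0.
  rewrite -mxrank_eq0 mxrank_ker subn_eq0 -ltnNge.
  exact: leq_ltn_trans (rank_leq_col A) ltJI.
case/rowV0Pn => v /sub_kermxP vA v0.
exists (fun i => v 0 (enum_rank i)); split.
  have /rV0Pn[u vu] := v0; exists (enum_val u); by rewrite enum_valK.
move=> j; have /rowP/(_ (enum_rank j)) := vA; rewrite !mxE => vAj.
rewrite (reindex _ (onW_bij _ (@enum_val_bij I))) -[RHS]vAj.
by apply: eq_bigr => u _; rewrite mxE enum_valK enum_rankK.
Qed.

Lemma sum_constz n (b : int) : \sum_(i < n) b = b * n%:Z.
Proof. by rewrite sumr_const card_ord -mulr_natr natz. Qed.

Lemma exists_lt_sum n (d : 'I_n -> int) b :
  \sum_i d i < b * n%:Z -> exists i, d i < b.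
Proof.
move=> lt; apply: contrapT => no; move: lt; apply/negP; rewrite -leNgt.
rewrite -sum_constz.
by apply: ler_sum => i _; rewrite leNgt; apply/negP => H; apply: no; exists i.
Qed.

Lemma exists_gt_sum n (d : 'I_n -> int) b :
  b * n%:Z < \sum_i d i -> exists i, b < d i.
Proof.
move=> lt; have [|i] := @exists_lt_sum n (fun i => - d i) (- b).
  by rewrite sumrN mulNr ltrN2.
by rewrite ltrN2; exists i.
Qed.

(** Riemann-Roch inequality on P^1. *)
Lemma h0_ge b : b + 1 <= (h0 b)%:Z.
Proof. by case: b => b /=; lia. Qed.

Lemma h0_nonneg b : 0 <= b -> (h0 b)%:Z = b + 1.
Proof. by case: b => b //=; lia. Qed.

Lemma size_mul_h0 (F : fieldType) (p q : {poly F}) b b' :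
  (size p <= h0 b)%N -> (size q <= h0 b')%N -> (size (p * q)%R <= h0 (b + b')%R)%N.
Proof.
have [->|p0] := eqVneq p 0; first by rewrite mul0r size_poly0.
have [->|q0] := eqVneq q 0; first by rewrite mulr0 size_poly0.
rewrite size_mul //; move: p0 q0; rewrite -!size_poly_eq0.
move: (size p) (size q) => u v.
by case: b b' => b [b'|b'] /=; lia.
Qed.

Section Splitting.
Variable R : realType.
Local Notation P := {poly R[i]}.
Local Notation chart0 := (@chart0 R).
Local Notation chart1 := (@chart1 R).

(** The theory of bundles in the form used by the counting arguments: [d] is the
    splitting type and [x] the basis of [V] in split coordinates. The last two
    clauses express stability against line subbundles and against kernels
    of maps to line bundles; denominators are cleared. *)
Lemma stable_splitting (alpha : R) n k (S : coherent_system R n.+1 k) :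
  stable alpha S -> (0 < n)%N ->
  let slope_num := (degree (bundle S))%:~R + alpha * k%:R in
  exists (d : 'I_n.+1 -> int) (x : 'I_k -> 'cV[P]_n.+1),
  [/\ \sum_i d i = degree (bundle S),
      forall j i, (size (x j i 0%R) <= h0 (d i))%N,
      forall c : 'I_k -> R[i], \sum_j (c j)%:P *: x j = 0 -> forall j, c j = 0,
      forall (p : 'cV[P]_n.+1) b m (C : 'I_m -> 'I_k -> R[i]),
        p != 0 -> (forall i, (size (p i 0%R) <= h0 (d i - b)%R)%N) ->
        (forall r : 'I_m, 'X^r *: p = \sum_j (C r j)%:P *: x j) ->
        (b%:~R + alpha * m%:R) * n.+1%:R < slope_num
    & forall (p : 'rV[P]_n.+1) b m (C : 'M[R[i]]_(m, k)),
        p != 0 -> (forall i, (size (p 0%R i) <= h0 (b - d i)%R)%N) ->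
        row_free C -> (forall r, p *m (\sum_j (C r j)%:P *: x j) = 0) ->
        ((degree (bundle S) - b)%:~R + alpha * m%:R) * n.+1%:R < slope_num * n%:R].
Proof.
move=> stS n0 D.
have [d [A [B [UA UB sumd gAB]]]] := birkhoff (bundle S).
have [v [vind vS]] := sections_dim S.
have Ev j : is_section (bundle S) (v j).
  apply: (@sections_H0 _ _ _ S); rewrite vS; exists (fun l => (l == j)%:R).
  rewrite (bigD1 j) //= eqxx scale1r big1 ?addr0 // => l /negbTE ->.
  by rewrite scale0r.
pose x j := invmx A *m (v j).1.
have slopeE : slope alpha S = D / n.+1%:R by [].
have xE c : A *m (\sum_j (c j)%:P *: x j) = (lincomb v c).1.
  rewrite lincomb1 mulmx_sumr; apply: eq_bigr => j _.
  by rewrite /x -scalemxAr mulKVmx.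
have xE' c : \sum_j (c j)%:P *: x j = invmx A *m (lincomb v c).1.
  by rewrite -xE mulKmx.
have Sl c : sections S (lincomb v c) by rewrite vS; exists c.
exists d, x; split=> //.
- move=> j i; have := Ev j; rewrite /is_section => E.
  have {}E : map_mx chart0 (x j) = diag_mx (\row_i zvar R ^ d i) *m
      map_mx chart1 (invmx B *m (v j).2).
    have AA : map_mx chart0 A *m map_mx chart0 (invmx A) = 1%:M.
      by rewrite -map_mxM (mulmxV UA) map_mx1.
    have [UcA _] := mulmx1_unit AA.
    rewrite -[LHS](mulKmx UcA) -map_mxM /x mulKVmx // E.
    rewrite -[(v j).2 in LHS](mulKVmx UB) map_mxM mulmxA gAB.
    by rewrite -mulmxA mulKmx.
  have /matrixP/(_ i 0) := E; rewrite mul_diag_mx [in RHS]mxE !mxE => E'.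
  exact: chart_size E'.
- move=> c xc j; apply: vind; rewrite -/(lincomb v c).
  apply: (@section_eq _ _ (bundle S)); first exact: section_lincomb.
    by rewrite /is_section !map_mx0 mulmx0.
  by rewrite -xE xc mulmx0.
- move=> p b m C p0 psz pC; rewrite -ltr_pdivlMr ?ltr0n // -slopeE.
  apply: (@line_subbundle_slope _ _ _ _ S d A B p b m
    (fun r => 'X^r) (fun r => lincomb v (C r))) => //.
    move=> c E r; have /polyP/(_ r) := E; rewrite coef0 => <-.
    rewrite coef_sum (bigD1 r) //= coefCM coefXn eqxx mulr1 big1 ?addr0 // => l lr.
    by rewrite coefCM coefXn eq_sym (inj_eq val_inj) (negbTE lr) mulr0.
  by move=> r; rewrite -xE pC.
- move=> p b m C p0 psz freeC pC.
  rewrite -ltr_pdivlMr ?ltr0n // mulrAC -slopeE -ltr_pdivrMr ?ltr0n //.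
  apply: (@kernel_subbundle_slope _ _ _ _ S d A B p b m (fun r => lincomb v (C r))) => //.
    move=> c; rewrite lincomb_lincomb => /vind cC r.
    have : (\row_l c l) *m C = 0.
      by apply/rowP => j; rewrite !mxE -[RHS](cC j); apply: eq_bigr => l _; rewrite mxE.
    move/eqP; rewrite mulmx_free_eq0 // => /eqP/rowP/(_ r).
    by rewrite !mxE.
  by move=> r; rewrite -xE' pC.
Qed.

End Splitting.

(** * Counting homomorphisms *)

Section Counting.
Variables (F : fieldType) (n : nat).
Implicit Type h : 'I_n -> nat.

(** Vectors of polynomials with [size p_i <= h i] are parametrized by their
    coefficients, indexed by the pairs of [i] and [l < h i]. *)
Definition poly_family h (c : {i : 'I_n & 'I_(h i)} -> F) (i : 'I_n) : {poly F} :=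
  \sum_(l < h i) c (Tagged (fun i => 'I_(h i)) l) *: 'X^l.

Lemma coef_poly_family h c (i : 'I_n) (l : 'I_(h i)) :
  (poly_family c i)`_l = c (Tagged (fun i => 'I_(h i)) l).
Proof.
rewrite coef_sum (bigD1 l) //= coefZ coefXn eqxx mulr1 big1 ?addr0 // => u ul.
by rewrite coefZ coefXn eq_sym (inj_eq val_inj) (negbTE ul) mulr0.
Qed.

Lemma size_poly_family h (c : {i : 'I_n & 'I_(h i)} -> F) i :
  (size (poly_family c i) <= h i)%N.
Proof.
apply: leq_trans (size_sum _ _ _) _; apply/bigmax_leqP => l _.
by apply: leq_trans (size_scale_leq _ _) _; rewrite size_polyXn.
Qed.

Lemma poly_family_eval h (c : {i : 'I_n & 'I_(h i)} -> F) (y : 'I_n -> {poly F}) e :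
  (\sum_i poly_family c i * y i)`_e =
  \sum_u c u * ('X^(tagged u) * y (tag u))`_e.
Proof.
rewrite coef_sum.
under eq_bigr do rewrite mulr_suml coef_sum.
rewrite (sig_big_dep (fun _ => true) (fun _ _ => true)
  (fun i l => (c (Tagged (fun i => 'I_(h i)) l) *: 'X^l * y i)`_e)) /=.
by apply: eq_bigr => -[i l] _ /=; rewrite -scalerAl coefZ.
Qed.

Lemma card_poly_family h : #|{: {i : 'I_n & 'I_(h i)}}| = (\sum_i h i)%N.
Proof.
rewrite card_tagged sumnE big_map big_enum.
by apply: eq_bigr => i _; rewrite card_ord.
Qed.

End Counting.

Lemma sum_Posz (I : finType) (f : I -> nat) :
  (\sum_i f i)%N%:Z = \sum_i (f i)%:Z.
Proof. exact: (big_morph Posz PoszD erefl). Qed.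

(** Unknowns: the coefficients of [p], at least [\sum_i (a + 1 - d_i)] of them.
    Equations: each [p *m x j] is a polynomial of degree at most [a]. *)
Lemma exists_hom_killing (F : fieldType) n k (d : 'I_n -> int)
    (x : 'I_k -> 'cV[{poly F}]_n) (a : nat) :
  (forall j i, size (x j i 0%R) <= h0 (d i))%N ->
  (k * a.+1)%:Z < \sum_i (a%:Z + 1 - d i) ->
  exists p : 'rV[{poly F}]_n, [/\ p != 0,
    forall i, (size (p 0%R i) <= h0 (a%:Z - d i)%R)%N & forall j, p *m x j = 0].
Proof.
move=> szx lt.
have [|c [[[i l] cil] cE]] :=
  @nontrivial_solution F {i : 'I_n & 'I_(h0 (a%:Z - d i))}
  ('I_k * 'I_a.+1)%type (fun u je => ('X^(tagged u) * x je.1 (tag u) 0)`_je.2).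
  rewrite card_prod !card_ord card_poly_family -ltz_nat; apply: lt_le_trans lt _.
  rewrite sum_Posz; apply: ler_sum => i _; apply: le_trans (h0_ge _); lia.
have szp := size_poly_family c.
exists (\row_i poly_family c i); split.
- apply: contra_neq cil => /rowP/(_ i); rewrite !mxE => /polyP/(_ l).
  by rewrite coef_poly_family coef0.
- by move=> i'; rewrite mxE.
- move=> j; apply/matrixP => i1 i2; rewrite !ord1 !mxE.
  under eq_bigr do rewrite mxE.
  apply/polyP => e; rewrite coef0; case: (ltnP e a.+1) => [lte|gee].
    by have := cE (j, Ordinal lte); rewrite -(poly_family_eval c (fun i => x j i 0)).
  apply: nth_default; apply: leq_trans gee; apply: leq_trans (size_sum _ _ _) _.
  apply/bigmax_leqP => i' _; have := size_mul_h0 (szp i') (szx j i').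
  by rewrite subrK.
Qed.

(** Unknowns: the coefficients of [p] and the matrix [C]. Equations: the
    coefficients of ['X^r *: p - \sum_j C r j x_j], which is a section of the
    bundle for each [r <= a]. A solution with [p = 0] has [C = 0], as the [x_j]
    are independent. *)
Lemma exists_line_with_sections (F : fieldType) n k (d : 'I_n -> int)
    (x : 'I_k -> 'cV[{poly F}]_n) (a : nat) :
  (forall j i, size (x j i 0%R) <= h0 (d i))%N ->
  (forall c : 'I_k -> F, \sum_j (c j)%:P *: x j = 0 -> forall j, c j = 0) ->
  (forall i, 0 <= d i) ->
  a.+1%:Z * \sum_i (d i + 1) < \sum_i (d i - a%:Z + 1) + (a.+1 * k)%:Z ->
  exists (p : 'cV[{poly F}]_n) (C : 'I_a.+1 -> 'I_k -> F), [/\ p != 0,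
    forall i, (size (p i 0%R) <= h0 (d i - a%:Z)%R)%N &
    forall r : 'I_a.+1, 'X^r *: p = \sum_j (C r j)%:P *: x j].
Proof.
move=> szx xind d0 lt.
pose I1 : finType := {i : 'I_n & 'I_(h0 (d i - a%:Z))}.
pose I2 : finType := ('I_a.+1 * 'I_k)%type.
pose J : finType := ('I_a.+1 * {i : 'I_n & 'I_(h0 (d i))})%type.
pose M (u : I1 + I2) (v : J) : F :=
  match u with
  | inl w =>
      ('X^(tagged w) * (if tag w == tag v.2 then 'X^(v.1) else 0))`_(tagged v.2)
  | inr rj => if rj.1 == v.1 then - (x rj.2 (tag v.2) 0)`_(tagged v.2) else 0
  end.
have [|c [cnz cE]] := @nontrivial_solution F (I1 + I2)%type J M.
  rewrite card_sum !card_prod !card_ord !card_poly_family -ltz_nat PoszD PoszM !sum_Posz.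
  rewrite (eq_bigr _ (fun i _ => h0_nonneg (d0 i))).
  apply: lt_le_trans lt _; rewrite lerD2r.
  by apply: ler_sum => i _; apply: h0_ge.
pose c1 (w : I1) := c (inl w).
pose C r j := c (inr (r, j)).
have szp := size_poly_family c1.
pose p : 'cV[{poly F}]_n := \col_i poly_family c1 i.
have pC (r : 'I_a.+1) : 'X^r *: p = \sum_j (C r j)%:P *: x j.
  apply/matrixP => i i'; rewrite !ord1 !mxE summxE.
  under eq_bigr do rewrite mxE.
  apply/polyP => e; case: (ltnP e (h0 (d i))) => [lte|gee].
    have := cE (r, Tagged (fun i => 'I_(h0 (d i))) (Ordinal lte)).
    rewrite big_sumType /= -(poly_family_eval c1 (fun l => if l == i then 'X^r else 0)).
    rewrite (bigD1 i) //= eqxx big1 ?addr0; last by move=> l /negbTE ->; rewrite mulr0.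
    have -> : \sum_(u : I2) c (inr u) * (if u.1 == r then - (x u.2 i 0)`_e else 0) =
        - \sum_j C r j * (x j i 0)`_e.
      rewrite -sumrN (eq_bigr (fun u : I2 => (fun r' j => c (inr (r', j)) *
        (if r' == r then - (x j i 0)`_e else 0)) u.1 u.2)); last by case.
      rewrite -(pair_bigA _ (fun r' j => c (inr (r', j)) *
        (if r' == r then - (x j i 0)`_e else 0))) /=.
      rewrite (bigD1 r) //= eqxx [X in _ + X]big1 ?addr0.
        by apply: eq_bigr => j _; rewrite mulrN.
      by move=> l /negbTE ->; rewrite big1 // => j _; rewrite mulr0.
    move=> E; rewrite mulrC coef_sum; apply/eqP; rewrite -subr_eq0 -[X in _ == X]E.
    by apply/eqP; congr (_ - _); apply: eq_bigr => j _; rewrite coefCM.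
  rewrite !nth_default //; apply: leq_trans gee.
    apply: leq_trans (size_sum _ _ _) _; apply/bigmax_leqP => j _.
    by rewrite mul_polyC; apply: leq_trans (size_scale_leq _ _) (szx j i).
  have szX : (size ('X^r : {poly F}) <= h0 a%:Z)%N by rewrite size_polyXn; apply: ltn_ord r.
  by have := size_mul_h0 szX (szp i); rewrite addrCA subrr addr0.
exists p, C; split=> //; last by move=> i; rewrite mxE.
apply/eqP => p0; case: cnz => -[[i l]|[r j]] /eqP[].
  have /matrixP/(_ i 0) := p0; rewrite !mxE => /polyP/(_ l).
  by rewrite coef_poly_family coef0.
by apply: (xind (C r)); rewrite -pC p0 scaler0.
Qed.

(** Vanishing of the polynomial in coordinate [i] amounts to [h] linear
    conditions. *)
Lemma kernel_of_coordinate (F : fieldType) n k (x : 'I_k -> 'cV[{poly F}]_n) i h :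
  (forall j, size (x j i 0%R) <= h)%N ->
  exists m (C : 'M[F]_(m, k)), [/\ row_free C, (k <= m + h)%N &
    forall r, (\sum_j (C r j)%:P *: x j) i 0 = 0].
Proof.
move=> szx; pose M : 'M[F]_(k, h) := \matrix_(j, l) (x j i 0)`_l.
exists (\rank (kermx M)), (row_base (kermx M)); split.
- exact: row_base_free.
- by rewrite mxrank_ker; have := rank_leq_col M; lia.
- move=> r; have CM : row_base (kermx M) *m M = 0.
    by apply/sub_kermxP; rewrite eq_row_base.
  rewrite summxE; apply/polyP => e; rewrite coef0 coef_sum.
  case: (ltnP e h) => [lte|gee].
    have /matrixP/(_ r (Ordinal lte)) := CM; rewrite mxE [RHS]mxE => E.
    by rewrite -[RHS]E; apply: eq_bigr => j _; rewrite mxE coefCM [M _ _]mxE.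
  by rewrite big1 // => j _; rewrite mxE coefCM nth_default ?mulr0 // (leq_trans (szx j)).
Qed.

Lemma size_delta_h0 (F : fieldType) n (d : 'I_n -> int) i j :
  (size ((i == j)%:R : {poly F}) <= h0 (d i - d j)%R)%N.
Proof.
by case: eqP => [->|_]; rewrite ?subrr ?size_poly1 ?size_poly0.
Qed.

Theorem theorem3p3 (R : realType) (n a t k : nat)
    (hn : (0 < n)%N) (ha : (2 <= a)%N) (ht : (1 <= t <= n - 1)%N)
    (hk : (0 < k)%N)
    (hcase :
      ((a * t <= k)%N /\
       (a%:Z - 1) * t%:Z > a%:Z * (a%:Z * n%:Z - k%:Z) + (a%:Z - 2) * n%:Z) \/
      ((k <= a * t)%N /\
       t%:Z > (a%:Z + 1) * k%:Z - n%:Z)) :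
  forall alpha : R, 0 < alpha ->
    moduli alpha n (a%:Z * n%:Z - t%:Z) k = set0.
Proof.
move=> alpha alpha0; apply/seteqP; split=> // X [S [degS stS] _].
exfalso; move: {X} S degS stS.
case: n hn ht hcase => // n _ ht hcase S degS stS.
have n0 : (0 < n)%N by move: ht; lia.
have [d [x [sumd szx xind line quot]]] := stable_splitting stS n0.
rewrite degS in sumd line quot.
pose N : R := n.+1%:R; pose w : R := alpha * k%:R.
have N0 : 0 < N by rewrite ltr0n.
have degR : (a%:Z * n.+1%:Z - t%:Z)%:~R = a%:R * N - t%:R :> R.
  by rewrite rmorphB rmorphM.
have nR : n%:R = N - 1 by rewrite /N -natr1 addrK.
(* The summand O(d i), together with no section. *)
have summand i : (d i)%:~R * N < a%:R * N - t%:R + w.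
  have := line (delta_mx i 0) (d i) 0%N (fun _ _ => 0).
  rewrite mulr0 addr0 degR; apply.
  - by apply/eqP => /matrixP/(_ i 0)/eqP; rewrite !mxE !eqxx oner_eq0.
  - by move=> i'; rewrite mxE andbT; apply: size_delta_h0.
  - by case.
(* The kernel of E -> O(d i), together with the sections of V that lie in it. *)
have projection i : a%:R * N - t%:R + w < ((d i)%:~R + alpha * (h0 (d i))%:R) * N.
  have [m [C [freeC km Ci]]] := kernel_of_coordinate (fun j => szx j i).
  have := quot (delta_mx 0 i) (d i) m C.
  rewrite rmorphB /= degR nR -/N -/w => /(_ _ _ freeC _) q.
  have {q} : (a%:R * N - t%:R - (d i)%:~R + alpha * m%:R) * N
      < (a%:R * N - t%:R + w) * (N - 1).
    apply: q.
    - by apply/eqP => /matrixP/(_ 0 i)/eqP; rewrite !mxE !eqxx oner_eq0.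
    - by move=> j; rewrite mxE eqxx /= eq_sym; apply: size_delta_h0.
    - move=> r; rewrite -rowE; apply/matrixP => u v; rewrite !ord1 mxE Ci.
      by rewrite mxE.
  have : (w - alpha * m%:R - alpha * (h0 (d i))%:R) * N <= 0.
    rewrite pmulr_lle0 // -addrA -opprD subr_le0 -mulrDr ler_pM2l //.
    by rewrite -natrD ler_nat.
  by move=> H1 H2; lra.
have w0 : 0 < w by rewrite mulr_gt0 // ltr0n.
case: hcase => -[kt ineq].
  (* From here on, [a] stands for what was [a - 1]. *)
  case: a ha degS sumd line quot degR summand projection kt ineq => // a.
  move=> ha degS sumd line quot degR summand projection kt ineq.
  have d0 i : 0 <= d i.
    rewrite leNgt; apply/negP => di.
    have := projection i; have -> : h0 (d i) = 0%N by case: (d i) di.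
    have diR : (d i)%:~R < 0 :> R by rewrite ltrz0.
    have tN : t%:R < N by rewrite ltr_nat; move: ht; lia.
    have aR : 1 <= a.+1%:R :> R by rewrite ler1n.
    rewrite mulr0 addr0; nra.
  have [i di] : exists i, d i < a.+1%:Z.
    by apply: exists_lt_sum; rewrite sumd; move: ht; nia.
  (* A summand of degree less than the average bounds alpha from below. *)
  have up : a.+1%:R * N - t%:R + w < (a%:R + alpha * a.+1%:R) * N.
    apply: lt_le_trans (projection i) _; rewrite ler_pM2r //; apply: lerD.
      by rewrite -[a%:R]/(a%:Z%:~R) ler_int; lia.
    rewrite ler_pM2l // ler_nat.
    by have := h0_nonneg (d0 i); lia.
  have [|p [C [p0 szp pC]]] := @exists_line_with_sections _ _ _ d x a szx xind d0.
    rewrite !big_split /= sumrN !sum_constz sumd; move: ineq; clear; nia.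
  have := line p a%:Z a.+1 C p0 szp pC.
  by rewrite degR => low; have := lt_trans low up; rewrite ltxx.
have [i di] : exists i, a%:Z - 1 < d i.
  by apply: exists_gt_sum; rewrite sumd; move: ht; nia.
(* A summand of degree larger than the average bounds alpha from below. *)
have tw : t%:R < w.
  have := summand i; have : a%:R * N <= (d i)%:~R * N.
    by rewrite ler_pM2r // -[a%:R]/(a%:Z%:~R) ler_int; lia.
  by move=> H1 H2; lra.
have [|p [p0 szp px]] := @exists_hom_killing _ _ _ d x a szx.
  rewrite sumrB sum_constz sumd; move: ineq; clear; nia.
have := quot p a%:Z k 1%:M p0 szp.
rewrite row_free_unit unitmx1 rmorphB /= degR nR -/N -/w => /(_ erefl) q.
have {q} : (a%:R * N - t%:R - a%:R + w) * N < (a%:R * N - t%:R + w) * (N - 1).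
  apply: q => r; rewrite (bigD1 r) //= big1 ?addr0.
    by rewrite !mxE eqxx scale1r.
  by move=> j jr; rewrite !mxE eq_sym (negbTE jr) scale0r.
by move=> H; lra.
Qed.
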